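(* Assume the standing assumptions (A1) and (A2) below. Let $t\in(1,2)$, $p\in(t,2]$, $\varrho>0$ and $x^+\in D$ with $\|x^+\|_{k_t}\le\varrho$. For $g\in\mathbb{Y}$ and $\alpha>0$, a minimizer means an element of $\operatorname{argmin}_{x\in D}\left[\frac12\|g-F(x)\|_{\mathbb{Y}}^2+\alpha\|x\|_{\overline{r},1}\right]$. (1) Let $\alpha>0$. For $g=F(x^+)$ every minimizer $x_\alpha$ satisfies $\|x^+-x_\alpha\|_{\overline{\omega}_p,p}\le C_b\varrho^{t/p}\alpha^{\frac{p-t}{p}}$ with $C_b$ depending only on $p,t,L$. (2) Let $\delta>0$, $g^{\mathrm{obs}}\in\mathbb{Y}$ with $\|g^{\mathrm{obs}}-F(x^+)\|_{\mathbb{Y}}\le\delta$, $0<c_1<c_2$, and $c_1\varrho^{\frac{t}{t-2}}\delta^{\frac{2}{2-t}}\le\alpha\le c_2\varrho^{\frac{t}{t-2}}\delta^{\frac{2}{2-t}}$. Then every minimizer $\hat{x}_\alpha$ for $g=g^{\mathrm{obs}}$ satisfies $\|\hat{x}_\alpha-x^+\|_{\overline{\omega}_p,p}\le C_c\varrho^{\frac{t(2-p)}{p(2-t)}}\delta^{\frac{2(p-t)}{p(2-t)}}$ with $C_c$ depending only on $c_1,c_2,p,t,L$. (3) Let $\delta>0$, $g^{\mathrm{obs}}\in\mathbb{Y}$ with $\|g^{\mathrm{obs}}-F(x^+)\|_{\mathbb{Y}}\le\delta$ and $1<\tau_1\le\tau_2$. If $\hat{x}_\alpha$ is a minimizer for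 $g=g^{\mathrm{obs}}$ with $\tau_1\delta\le\|F(\hat{x}_\alpha)-g^{\mathrm{obs}}\|_{\mathbb{Y}}\le\tau_2\delta$, then $\|\hat{x}_\alpha-x^+\|_{\overline{\omega}_p,p}\le C_d\varrho^{\frac{t(2-p)}{p(2-t)}}\delta^{\frac{2(p-t)}{p(2-t)}}$ with $C_d$ depending only on $\tau_1,\tau_2,p,t,L$.
   Context: $\Lambda$ is a countable index set. For a sequence $\omega$ of positive reals and $p\in(0,\infty)$, $\|x\|_{\omega,p}=\left(\sum_{j\in\Lambda}\omega_j^p|x_j|^p\right)^{1/p}$ (possibly $+\infty$) and $\ell^p_\omega=\{x\in\mathbb{R}^\Lambda:\|x\|_{\omega,p}<\infty\}$. For $s\in(0,2]$, $(\overline{\omega}_s)_j=(\overline{a}_j^{2s-2}\overline{r}_j^{2-s})^{1/s}$. For $t\in(0,2)$, $k_t=\{x:\|x\|_{k_t}<\infty\}$ with $\|x\|_{k_t}=\sup_{\alpha>0}\alpha\left(\sum_{j}\overline{a}_j^{-2}\overline{r}_j^2\mathbf{1}_{\{\overline{a}_j^{-2}\overline{r}_j\alpha<|x_j|\}}\right)^{1/t}$. (A1): $\overline{a},\overline{r}$ are sequences of positive reals indexed by $\Lambda$ such that for every $\varepsilon>0$ all but finitely many $j$ satisfy $\overline{a}_j\overline{r}_j^{-1}\le\varepsilon$; $\mathbb{Y}$ is a Banach space; $D\subseteq\ell^2_{\overline{a}}$ is closed with $D\cap\ell^1_{\overline{r}}\ne\emptyset$; $F:D\to\mathbb{Y}$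 and there is $L>0$ with $L^{-1}\|x^{(1)}-x^{(2)}\|_{\overline{a},2}\le\|F(x^{(1)})-F(x^{(2)})\|_{\mathbb{Y}}\le L\|x^{(1)}-x^{(2)}\|_{\overline{a},2}$ for all $x^{(1)},x^{(2)}\in D$. (A2): if $x\in D$ and $z\in\ell^2_{\overline{a}}$ with $|z_j|\le|x_j|$ for all $j$, then $z\in D$. *)

(* Defs.v *)
From HB Require Import structures.
From mathcomp Require Import all_boot all_order all_algebra.
From mathcomp Require Import all_classical all_reals all_analysis.
Set Implicit Arguments. Unset Strict Implicit. Unset Printing Implicit Defensive.
Import Order.TTheory GRing.Theory Num.Theory.
Import numFieldNormedType.Exports.
Local Open Scope classical_set_scope.
Local Open Scope ring_scope.

Definition wnorm {R : realType} {L : countType} (w : L -> R) (p : R) (x : L -> R)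
  : \bar R :=
  ((\esum_(j in [set: L]) ((w j `^ p) * (`|x j| `^ p))%:E) `^ p^-1)%E.

Definition omegabar {R : realType} {L : countType} (a r : L -> R) (s : R) : L -> R :=
  fun j => (a j `^ (2 * s - 2) * r j `^ (2 - s)) `^ s^-1.

Definition ktnorm {R : realType} {L : countType} (a r : L -> R) (t : R) (x : L -> R)
  : \bar R :=
  ereal_sup [set ((al%:E *
      ((\esum_(j in [set: L])
          (if (a j) ^- 2 * r j * al < `|x j| then (a j) ^- 2 * (r j) ^+ 2 else 0)%:E)
        `^ t^-1))%E) | al in [set al : R | 0 < al]].

Definition vsub {R : realType} {L : countType} (x y : L -> R) : L -> R :=
  fun j => x j - y j.

Definition A1 {R : realType} {L : countType} {Y : completeNormedModType R}
  (a r : L -> R) (D : set (L -> R)) (F : (L -> R) -> Y) (Lc : R) : Prop :=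
  ((forall j, 0 < a j) /\ (forall j, 0 < r j)) /\
      (forall eps : R, 0 < eps -> finite_set [set j | eps < a j / r j]) /\
      (forall x, D x -> (wnorm a 2 x < +oo)%E) /\
      (forall (u : nat -> L -> R) (x : L -> R),
          (forall n, D (u n)) -> (wnorm a 2 x < +oo)%E ->
          (forall eps : R, 0 < eps -> exists N, forall n, (N <= n)%N ->
              (wnorm a 2 (vsub (u n) x) <= eps%:E)%E) ->
          D x) /\
      (exists x, D x /\ (wnorm r 1 x < +oo)%E) /\
      0 < Lc /\
      (forall x1 x2, D x1 -> D x2 ->
         (Lc^-1%:E * wnorm a 2 (vsub x1 x2) <= (`|F x1 - F x2|)%:E)%E /\
         ((`|F x1 - F x2|)%:E <= Lc%:E * wnorm a 2 (vsub x1 x2))%E).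

Definition A2 {R : realType} {L : countType} (a : L -> R) (D : set (L -> R)) : Prop :=
  forall x z, D x -> (wnorm a 2 z < +oo)%E -> (forall j, `|z j| <= `|x j|) -> D z.

Definition minimizer {R : realType} {L : countType} {Y : completeNormedModType R}
  (r : L -> R) (D : set (L -> R)) (F : (L -> R) -> Y) (g : Y) (al : R) (x : L -> R)
  : Prop :=
  let J := fun z => ((2^-1 * `|g - F z| ^+ 2)%:E + al%:E * wnorm r 1 z)%E in
  D x /\ forall y, D y -> (J x <= J y)%E.

(* Main.v *)
(* With the measure [weight j = a_j^-2 r_j^2] and the rescaling
   [y_j = a_j^2 x_j / r_j], every norm weighted by [omegabar a r s] is the norm
   of [y] in L^s(weight), and the norm of k_t is that of weak L^t.  Truncate x^+
   to the coordinates with |y_j| > b: since 1 < t < 2, the truncation T has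
   l^1-norm O(rho^t b^(1-t)) and lies at squared l^2-distance O(rho^t b^(2-t))
   from x^+, and T is in D by (A2).  Comparing a minimizer x with T (b = alpha
   for an a priori choice, b balancing rho^t b^(2-t) against delta^2 for the
   discrepancy principle) yields bounds of the same orders for the l^1-norm of x
   and for |F x - F x^+|^2, hence for the l^2-distance of x to x^+.  The L^p
   distance is controlled pointwise: for u = y(x^+) and v = y(x),
   |u - v|^p <= b^(p-2) |u - v|^2 + b^p 1_{|u|>b} + 4 |u|^p 1_{|u|<=b}
   + 8 b^(p-1) |v|. *)
Require Import Defs.
From HB Require Import structures.
From mathcomp Require Import all_boot all_order all_algebra.
From mathcomp Require Import all_classical all_reals all_analysis.
From mathcomp Require Import finmap ring lra.
Set Implicit Arguments.
Unset Strict Implicit.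
Unset Printing Implicit Defensive.
Import Order.TTheory GRing.Theory Num.Theory.
Import numFieldNormedType.Exports.
Local Open Scope classical_set_scope.
Local Open Scope ring_scope.

(** * Real upper bounds for sums over the index set *)

Section Esum.
Context {R : realType} {L : choiceType}.
Implicit Types (f g : L -> R) (B : R).

Lemma esum_EFin_leP f B : (forall j, 0 <= f j) ->
  (\esum_(j in [set: L]) (f j)%:E <= B%:E)%E <->
  (forall X : {fset L}, \sum_(j <- X) f j <= B).
Proof.
move=> f0; split=> [fB X|fB].
  rewrite -lee_fin (le_trans _ fB)//; apply: esum_ge.
  exists [set` X]; first by split.
  by rewrite fsbig_finite//= set_fsetK sumEFin.
apply: ge_ereal_sup => _ [X [finX _] <-].
by rewrite fsbig_finite//= sumEFin lee_fin.
Qed.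

Lemma le_esum_EFin f g B : (forall j, f j <= g j) ->
  (\esum_(j in [set: L]) (g j)%:E <= B%:E)%E ->
  (\esum_(j in [set: L]) (f j)%:E <= B%:E)%E.
Proof. by move=> fg; apply: le_trans; apply: le_esum => j _; rewrite lee_fin. Qed.

Lemma esum_EFinD f g (A B : R) : (forall j, 0 <= f j) -> (forall j, 0 <= g j) ->
  (\esum_(j in [set: L]) (f j)%:E <= A%:E)%E ->
  (\esum_(j in [set: L]) (g j)%:E <= B%:E)%E ->
  (\esum_(j in [set: L]) (f j + g j)%:E <= (A + B)%:E)%E.
Proof.
move=> f0 g0 fA gB; rewrite EFinD (le_trans _ (leeD fA gB))//.
rewrite -esumD; [by apply: le_esum => j _; rewrite EFinD|by move=> *; rewrite lee_fin..].
Qed.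

Lemma esum_EFinZ f (c B : R) : 0 <= c -> (forall j, 0 <= f j) ->
  (\esum_(j in [set: L]) (f j)%:E <= B%:E)%E ->
  (\esum_(j in [set: L]) (c * f j)%:E <= (c * B)%:E)%E.
Proof.
move=> c0 f0 /(esum_EFin_leP _ f0) fB.
by apply/esum_EFin_leP => [j|X]; [exact: mulr_ge0|rewrite -mulr_sumr ler_wpM2l].
Qed.

(** On a finite set of indices one [n] serves all of them, because the partial sums of the [g k]
    increase with [n]; the two finite sums are then exchanged. *)
Lemma esum_EFin_series f (g : nat -> L -> R) (c : nat -> R) B :
  (forall j, 0 <= f j) -> (forall k j, 0 <= g k j) ->
  (forall j, exists n, f j <= \sum_(k < n) g k j) ->
  (forall k, (\esum_(j in [set: L]) (g k j)%:E <= (c k)%:E)%E) ->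
  (forall n, \sum_(k < n) c k <= B) ->
  (\esum_(j in [set: L]) (f j)%:E <= B%:E)%E.
Proof.
move=> f0 g0 fg gc cB; apply/esum_EFin_leP => // X.
have [n fgn] : exists n, forall j, j \in (X : seq L) -> f j <= \sum_(k < n) g k j.
  elim: (X : seq L) => [|j s [m fgm]]; first by exists 0%N.
  have gmon i p q : (p <= q)%N -> \sum_(k < p) g k i <= \sum_(k < q) g k i.
    move=> pq; rewrite -!(big_mkord xpredT (g^~ i)) (big_cat_nat (leq0n p) pq)//= lerDl.
    exact: sumr_ge0.
  have [n fgn] := fg j.
  exists (maxn m n) => i; rewrite inE => /predU1P[->|/fgm fgi].
    by rewrite (le_trans fgn)// gmon// leq_maxr.
  by rewrite (le_trans fgi)// gmon// leq_maxl.
rewrite (le_trans _ (cB n))// big_seq (le_trans (ler_sum _ fgn))// -big_seq.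
rewrite exchange_big/=; apply: ler_sum => k _.
by move: (gc k) => /(esum_EFin_leP _ (g0 k)); apply.
Qed.

End Esum.

Lemma poweR_inv_leP {R : realType} (S : \bar R) (q b : R) : 0 < q -> 0 <= b ->
  (0 <= S)%E -> (poweR S q^-1 <= b%:E)%E <-> (S <= (b `^ q)%:E)%E.
Proof.
move=> q0 b0; have qn0 : q != 0 by rewrite gt_eqF.
case: S => [s| |]//=; last by rewrite invr_eq0 (negbTE qn0) !leye_eq.
rewrite !lee_fin => s0; split=> /ge0_ler_powR h.
  have := h _ (ltW q0); rewrite -powRrM mulVf// powRr1//.
  by apply; rewrite nnegrE ?powR_ge0.
have qi0 : 0 <= q^-1 by rewrite invr_ge0 ltW.
have := h _ qi0; rewrite -powRrM mulfV// powRr1//.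
by apply; rewrite nnegrE ?powR_ge0.
Qed.

Lemma powR_mul_exprn {R : realType} (b h s : R) k : 0 <= b -> 0 <= h ->
  (b * h ^+ k) `^ s = b `^ s * (h `^ s) ^+ k.
Proof.
move=> b0 h0; rewrite powRM ?exprn_ge0// -powR_mulrn// powRAC.
by rewrite powR_mulrn ?powR_ge0.
Qed.

(** * Dyadic summation for a function of weak type [t] *)

Section WeakType.
Context {R : realType} {L : choiceType}.
Variables (mu y : L -> R) (t N : R).
Hypotheses (mu0 : forall j, 0 <= mu j) (y0 : forall j, 0 <= y j).
Hypotheses (t0 : 0 < t) (N0 : 0 <= N).
Hypothesis weak : forall al : R, 0 < al ->
  (\esum_(j in [set: L]) (if (al < y j)%R then mu j else 0)%:E
     <= (N * al `^ (- t))%:E)%E.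

(** A geometric series of ratio 2^(t - q); the numerator 2^t arises because the weak bound is taken
    at the lower edge of each layer. *)
Definition low_const (q : R) : R := 2^-1 `^ (- t) / (1 - 2^-1 `^ (q - t)).

(** A geometric series of ratio 2^(1 - t), below 1 when [1 < t]; the factor 2 is the ratio of the
    two edges of a layer. *)
Definition high_const : R := 2 / (1 - 2 `^ (1 - t)).

Let half : 0 < 2^-1 :> R. Proof. by rewrite invr_gt0. Qed.

Lemma half_powR_lt1 (q : R) : t < q -> 2^-1 `^ (q - t) < 1 :> R.
Proof.
move=> tq; have := @gt0_ltr_powR R (q - t); rewrite subr_gt0 => /(_ tq (2^-1) 1).
rewrite powR1; apply; rewrite ?nnegrE ?(ltW half)//.
by rewrite invf_lt1// ltr1n.
Qed.

Lemma two_powR_lt1 : 1 < t -> 2 `^ (1 - t) < 1 :> R.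
Proof.
move=> t1; rewrite -opprB powRN invf_lt1 ?powR_gt0//.
have := @gt0_ltr_powR R (t - 1); rewrite subr_gt0 => /(_ t1 1 2).
by rewrite powR1; apply; rewrite ?nnegrE ?ltr1n.
Qed.

Lemma low_const_ge0 (q : R) : t < q -> 0 <= low_const q.
Proof.
by move=> tq; rewrite divr_ge0 ?powR_ge0// subr_ge0 ltW// half_powR_lt1.
Qed.

Lemma high_const_ge0 : 1 < t -> 0 <= high_const.
Proof. by move=> t1; rewrite divr_ge0// subr_ge0 ltW// two_powR_lt1. Qed.

(* Summation over the layers [b / 2 ^ k.+1 < y <= b / 2 ^ k]. *)
Lemma esum_weak_below (q b : R) : t < q -> 0 < b ->
  (\esum_(j in [set: L]) (if (b < y j)%R then 0 else mu j * y j `^ q)%:E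
     <= (low_const q * (N * b `^ (q - t)))%:E)%E.
Proof.
move=> tq b0; have q0 : 0 < q := lt_trans t0 tq.
have bh0 k : 0 < b * 2^-1 ^+ k by rewrite mulr_gt0 ?exprn_gt0.
(* The power is bounded by its value at the upper edge of layer [k], and the layer is enlarged to
   the superlevel set of its lower edge, where [weak] applies. *)
pose g k j : R := (b * 2^-1 ^+ k) `^ q *
  (if b * 2^-1 ^+ k.+1 < y j then mu j else 0).
pose c k : R := (b * 2^-1 ^+ k) `^ q * (N * (b * 2^-1 ^+ k.+1) `^ (- t)).
have ite0 k j : 0 <= (if b * 2^-1 ^+ k < y j then mu j else 0) by case: ifP.
apply: (@esum_EFin_series _ _ _ g c).
- by move=> j; case: ifP => // _; rewrite mulr_ge0 ?powR_ge0.
- by move=> k j; rewrite mulr_ge0 ?powR_ge0.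
- move=> j; have [yj0|yj0] := leP (y j) 0.
    have -> : y j = 0 by apply/le_anti; rewrite yj0 y0.
    by exists 0%N; rewrite big_ord0 powR0 ?gt_eqF// mulr0; case: ifP.
  have fgn n : b * 2^-1 ^+ n < y j ->
      (if b < y j then 0 else mu j * y j `^ q) <= \sum_(k < n) g k j.
    elim: n => [|n IHn]; first by rewrite expr0 mulr1 big_ord0 => ->.
    move=> yjn; rewrite big_ord_recr/=.
    have [/IHn yn|yn] := ltP (b * 2^-1 ^+ n) (y j).
      by rewrite (le_trans yn)// lerDl mulr_ge0 ?powR_ge0.
    case: ifP => _; first by rewrite addr_ge0 ?sumr_ge0// => *; rewrite mulr_ge0 ?powR_ge0.
    rewrite (@le_trans _ _ (g n j))//; last first.
      by rewrite lerDr sumr_ge0// => *; rewrite mulr_ge0 ?powR_ge0.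
    rewrite /g yjn mulrC ler_wpM2r// ge0_ler_powR ?nnegrE//; exact: ltW.
  (* 2 to the power [Num.bound x] exceeds [x], so the layers up to this index reach down to
     [y j]. *)
  exists (Num.bound (b / y j)); apply: fgn.
  rewrite exprVn ltr_pdivrMr ?exprn_gt0// mulrC -ltr_pdivrMr//.
  exact: upper_nthrootP.
- by move=> k; apply: esum_EFinZ; rewrite ?powR_ge0// => *; exact: weak.
- move=> n; pose z : R := 2^-1 `^ (q - t).
  have cE k : c k = (N * b `^ (q - t) * 2^-1 `^ (- t)) * z ^+ k.
    rewrite /c !powR_mul_exprn ?(ltW half) ?(ltW b0)// /z.
    rewrite !powRD ?(gt_eqF half) ?(gt_eqF b0) ?implybT// exprS exprMn.
    ring.
  have z0 : 0 < z by rewrite powR_gt0.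
  have z1 : z < 1 by exact: half_powR_lt1.
  have A0 : 0 <= N * b `^ (q - t) * 2^-1 `^ (- t) by rewrite !mulr_ge0 ?powR_ge0.
  have := geometric_le_lim n A0 z0; rewrite ger0_norm ?(ltW z0)// => /(_ z1).
  rewrite /series/= big_mkord (eq_bigr _ (fun (i : 'I_n) _ => cE i)).
  by move=> /le_trans; apply; rewrite /low_const -/z; lra.
Qed.

(* Summation over the layers [b * 2 ^ k < y <= b * 2 ^ k.+1]. *)
Lemma esum_weak_above (b : R) : 1 < t -> 0 < b ->
  (\esum_(j in [set: L]) (if (b < y j)%R then mu j * y j else 0)%:E
     <= (high_const * (N * b `^ (1 - t)))%:E)%E.
Proof.
move=> t1 b0; have bh0 k : 0 < b * 2 ^+ k by rewrite mulr_gt0 ?exprn_gt0.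
pose g k j : R := (2 * (b * 2 ^+ k)) *
  (if b * 2 ^+ k < y j then mu j else 0).
pose c k : R := (2 * (b * 2 ^+ k)) * (N * (b * 2 ^+ k) `^ (- t)).
have ite0 k j : 0 <= (if b * 2 ^+ k < y j then mu j else 0) by case: ifP.
have g0 k j : 0 <= g k j by rewrite !mulr_ge0// ltW.
apply: (@esum_EFin_series _ _ _ g c) => //.
- by move=> j; case: ifP => // _; rewrite mulr_ge0.
- move=> j.
  have fgn n : y j <= b * 2 ^+ n ->
      (if b < y j then mu j * y j else 0) <= \sum_(k < n) g k j.
    elim: n => [|n IHn].
      by rewrite expr0 mulr1 big_ord0 leNgt => /negbTE ->.
    move=> yjn; rewrite big_ord_recr/=.
    have [yn|/IHn yn] := ltP (b * 2 ^+ n) (y j); last first.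
      by rewrite (le_trans yn)// lerDl.
    case: ifP => _; last by rewrite addr_ge0 ?sumr_ge0.
    rewrite (@le_trans _ _ (g n j))//; last by rewrite lerDr sumr_ge0.
    by rewrite /g yn mulrC ler_wpM2r// mulrCA -exprS.
  exists (Num.bound (y j / b)); apply: fgn.
  rewrite mulrC -ler_pdivrMr// ltW//; exact: upper_nthrootP.
- by move=> k; apply: esum_EFinZ => //; [rewrite mulr_ge0// ltW|exact: weak].
- move=> n; pose z : R := 2 `^ (1 - t).
  have cE k : c k = (2 * (N * b `^ (1 - t))) * z ^+ k.
    rewrite /c !powR_mul_exprn ?(ltW b0)// /z.
    rewrite !powRD ?(gt_eqF b0) ?pnatr_eq0 ?implybT// !powRr1 ?(ltW b0)// exprMn.
    ring.
  have z0 : 0 < z by rewrite powR_gt0.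
  have z1 : z < 1 by exact: two_powR_lt1.
  have A0 : 0 <= 2 * (N * b `^ (1 - t)) by rewrite !mulr_ge0 ?powR_ge0.
  have := geometric_le_lim n A0 z0; rewrite ger0_norm ?(ltW z0)// => /(_ z1).
  rewrite /series/= big_mkord (eq_bigr _ (fun (i : 'I_n) _ => cE i)).
  by move=> /le_trans; apply; rewrite /high_const -/z; lra.
Qed.

End WeakType.

(** If |u - v| >= b, the first term suffices because p - 2 <= 0. If |u - v| < b < |u|, the second
    does. Otherwise |v| <= 2 b, and |u - v|^p is split between |u|^p and |v|^p, the latter being at
    most 2 b^(p - 1) |v|. *)
Lemma powR_norm_sub_le {R : realType} (u v b p : R) : 0 < b -> 1 <= p <= 2 ->
  `|u - v| `^ p <= b `^ (p - 2) * `|u - v| `^ 2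
    + b `^ p * (if b < `|u| then 1 else 0)
    + 4 * (if b < `|u| then 0 else `|u| `^ p)
    + 8 * b `^ (p - 1) * `|v|.
Proof.
move=> b0 /andP[p1 p2]; have p0 : 0 < p by lra.
have mon := @ge0_ler_powR R p (ltW p0).
set d := `|u - v|.
have A0 : 0 <= b `^ (p - 2) * d `^ 2 by rewrite mulr_ge0 ?powR_ge0.
have B0 : 0 <= b `^ p * (if b < `|u| then 1 else 0).
  by rewrite mulr_ge0 ?powR_ge0//; case: ifP.
have C0 : 0 <= 4 * (if b < `|u| then 0 else `|u| `^ p).
  by rewrite mulr_ge0//; case: ifP => // _; rewrite powR_ge0.
have E0 : 0 <= 8 * b `^ (p - 1) * `|v| by rewrite !mulr_ge0 ?powR_ge0.
have [bd|db] := leP b d.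
  suff : d `^ p <= b `^ (p - 2) * d `^ 2 by lra.
  have d0 : 0 < d := lt_le_trans b0 bd.
  have -> : d `^ p = d `^ (p - 2) * d `^ 2.
    by rewrite -powRD ?subrK// (gt_eqF d0) implybT.
  rewrite ler_wpM2r ?powR_ge0// -opprB !powRN lef_pV2 ?posrE ?powR_gt0//.
  by apply: ge0_ler_powR; rewrite ?nnegrE; lra.
have [bu|ub] := ltP b `|u|; rewrite ?bu in B0 C0 *.
  have : d `^ p <= b `^ p by apply: mon; rewrite ?nnegrE ?normr_ge0//; exact: ltW.
  lra.
rewrite !mulr0.
have duv : d <= `|u| + `|v| by exact: ler_normB.
have vb : `|v| <= 2 * b.
  have : `|v| <= `|u| + `|u - v|.
    by rewrite -{1}(subKr u v) (le_trans (ler_normB _ _)).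
  rewrite -/d; lra.
have two_powR s : 0 <= s -> s <= 2 -> 2 `^ s <= 4 :> R.
  move=> s0 s2; rewrite (le_trans (ler_powR _ s2)) ?ler1n//.
  by rewrite powR_mulrn//; lra.
(* The sum |u| + |v| is at most twice the larger of the two, and 2^p <= 4. *)
have dp : d `^ p <= 4 * (`|u| `^ p + `|v| `^ p).
  have [m [m0 dm mp]] : exists m, [/\ 0 <= m, d <= 2 * m &
      m `^ p <= `|u| `^ p + `|v| `^ p].
    have [vu|/ltW uv] := leP `|v| `|u|.
      by exists `|u|; split=> //; [lra|rewrite lerDl powR_ge0].
    by exists `|v|; split=> //; [lra|rewrite lerDr powR_ge0].
  rewrite (@le_trans _ _ ((2 * m) `^ p))//.
    by apply: mon; rewrite ?nnegrE//; [exact: normr_ge0|lra].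
  by rewrite powRM// ler_pM ?powR_ge0// two_powR// ltW.
have vp : `|v| `^ p <= 2 * b `^ (p - 1) * `|v|.
  rewrite -mulr_powRB1// mulrC ler_wpM2r//.
  have p10 : 0 <= p - 1 by lra.
  apply: (@le_trans _ _ ((2 * b) `^ (p - 1))).
    by apply: ge0_ler_powR; rewrite ?nnegrE ?mulr_ge0// ltW.
  rewrite powRM ?(ltW b0)// ler_wpM2r ?powR_ge0//.
  have p11 : p - 1 <= 1 by lra.
  by rewrite (le_trans (ler_powR _ p11)) ?ler1n ?powRr1.
have -> : 8 * b `^ (p - 1) * `|v| = 4 * (2 * b `^ (p - 1) * `|v|) by ring.
lra.
Qed.

(** * L^p distance from L^1 and L^2 bounds at a threshold [b] *)

Section Interpolation.
Context {R : realType} {L : choiceType}.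
Variables (mu u v : L -> R) (t N p b K1 K2 : R).
Hypotheses (mu0 : forall j, 0 <= mu j) (t12 : 1 < t < 2) (tp2 : t < p <= 2).
Hypotheses (N0 : 0 <= N) (b0 : 0 < b).
Hypothesis weak : forall al : R, 0 < al ->
  (\esum_(j in [set: L]) (if (al < `|u j|)%R then mu j else 0)%:E
     <= (N * al `^ (- t))%:E)%E.

(** The pointwise inequality is summed against [mu]. Its powers of [b] make all four sums of the
    same order N b^(p - t); the four summands of the constant correspond to its four terms in
    order. *)
Lemma esum_powR_sub_le :
  (\esum_(j in [set: L]) (mu j * `|u j - v j| `^ 2)%:E
     <= (K2 * (N * b `^ (2 - t)))%:E)%E ->
  (\esum_(j in [set: L]) (mu j * `|v j|)%:E
     <= (K1 * (N * b `^ (1 - t)))%:E)%E ->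
  (\esum_(j in [set: L]) (mu j * `|u j - v j| `^ p)%:E
     <= ((K2 + 1 + 4 * low_const t p + 8 * K1) * (N * b `^ (p - t)))%:E)%E.
Proof.
move=> l2 l1; have /andP[t1 t2] := t12; have /andP[tp p2] := tp2.
have t0 : 0 < t by lra.
have := @esum_weak_below R L mu (fun j => `|u j|) t N mu0 (fun=> normr_ge0 _)
  t0 N0 weak p b tp b0 => low.
have := weak b0 => high.
have ite0 j : 0 <= (if b < `|u j| then mu j else 0) by case: ifP.
have low0 j : 0 <= (if b < `|u j| then 0 else mu j * `|u j| `^ p).
  by case: ifP => // _; rewrite mulr_ge0 ?powR_ge0.
have l20 j : 0 <= mu j * `|u j - v j| `^ 2 by rewrite mulr_ge0 ?powR_ge0.
have l10 j : 0 <= mu j * `|v j| by rewrite mulr_ge0.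
have bp0 := powR_ge0 b p; have b20 := powR_ge0 b (p - 2).
have b10 : 0 <= 8 * b `^ (p - 1) by rewrite mulr_ge0 ?powR_ge0.
have four0 : 0 <= 4 :> R by [].
have := esum_EFinD _ _ (esum_EFinD _ _ (esum_EFinD _ _
  (esum_EFinZ b20 l20 l2) (esum_EFinZ bp0 ite0 high))
  (esum_EFinZ four0 low0 low)) (esum_EFinZ b10 l10 l1).
have -> : b `^ (p - 2) * (K2 * (N * b `^ (2 - t))) + b `^ p * (N * b `^ (- t)) +
    4 * (low_const t p * (N * b `^ (p - t))) +
    8 * b `^ (p - 1) * (K1 * (N * b `^ (1 - t))) =
    (K2 + 1 + 4 * low_const t p + 8 * K1) * (N * b `^ (p - t)).
  have E s : b `^ (p - t) = b `^ (p - s) * b `^ (s - t).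
    by rewrite -powRD ?(gt_eqF b0) ?implybT//; congr (b `^ _); ring.
  have -> : b `^ (p - 2) * (K2 * (N * b `^ (2 - t))) = K2 * (N * b `^ (p - t)).
    by rewrite (E 2); ring.
  have -> : b `^ p * (N * b `^ (- t)) = N * b `^ (p - t).
    by rewrite (E 0) subr0 sub0r; ring.
  have -> : 8 * b `^ (p - 1) * (K1 * (N * b `^ (1 - t))) =
      8 * K1 * (N * b `^ (p - t)) by rewrite (E 1); ring.
  ring.
move=> bound; refine (le_esum_EFin _ (bound _ _ _ _ _ _)) => j;
  try by do ?[apply: addr_ge0|apply: mulr_ge0]; rewrite ?powR_ge0.
have p12 : 1 <= p <= 2 by lra.
rewrite (le_trans (ler_wpM2l (mu0 j) (powR_norm_sub_le (u j) (v j) b0 p12)))//.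
by case: ifP => _; rewrite le_eqVlt; apply/orP; left; apply/eqP; ring.
Qed.
End Interpolation.

(** * Weighted norms as norms of the rescaled sequence *)

Section Rescale.
Context {R : realType} {L : countType}.
Variables (a r : L -> R).
Hypotheses (a0 : forall j, 0 < a j) (r0 : forall j, 0 < r j).
Implicit Types x : L -> R.

Definition weight (j : L) : R := a j ^- 2 * r j ^+ 2.

Definition rescale x (j : L) : R := a j ^+ 2 * x j / r j.

Lemma weight_ge0 j : 0 <= weight j.
Proof. by rewrite mulr_ge0 ?invr_ge0 ?exprn_ge0 ?ltW. Qed.

Lemma rescale_sub x y j : rescale (vsub x y) j = rescale x j - rescale y j.
Proof. by rewrite /rescale /vsub; ring. Qed.

Lemma norm_rescale x j : `|rescale x j| = a j ^+ 2 * `|x j| / r j.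
Proof. by rewrite !normrM normfV (gtr0_norm (r0 j)) ger0_norm ?exprn_ge0 ?ltW. Qed.

Lemma threshold_rescale x (al : R) j :
  (a j ^- 2 * r j * al < `|x j|) = (al < `|rescale x j|).
Proof.
rewrite norm_rescale ltr_pdivlMr// -(ltr_pM2l (x := a j ^+ 2)) ?exprn_gt0//.
by congr (_ < _); field; rewrite gt_eqF.
Qed.

(** Both sides equal a^(2s - 2) r^(2 - s) |x|^s, so a single measure serves all exponents [s]. *)
Lemma omegabar_powR (s : R) x j : 0 < s ->
  omegabar a r s j `^ s * `|x j| `^ s = weight j * `|rescale x j| `^ s.
Proof.
move=> s0; have aj := ltW (a0 j); have rj := ltW (r0 j).
rewrite /omegabar -powRrM mulVf ?gt_eqF// powRr1 ?mulr_ge0 ?powR_ge0//.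
rewrite norm_rescale /weight -!powR_mulrn// -powRN -(powR_inv1 rj).
rewrite !powRM ?mulr_ge0 ?powR_ge0// -!powRrM.
rewrite addrC !powRD ?(gt_eqF (a0 j)) ?(gt_eqF (r0 j)) ?implybT// !mulN1r.
ring.
Qed.

Lemma wnorm_omegabar (s : R) x : 0 < s -> wnorm (omegabar a r s) s x =
  ((\esum_(j in [set: L]) (weight j * `|rescale x j| `^ s)%:E) `^ s^-1)%E.
Proof.
by move=> s0; congr poweR; apply: eq_esum => j _; rewrite omegabar_powR.
Qed.

(* Both norms of the Tikhonov functional belong to the family of the norms
   weighted by [omegabar a r s]. *)
Lemma omegabar2 : omegabar a r 2 = a.
Proof.
apply/funext => j; rewrite /omegabar subrr powRr0 mulr1.
rewrite (_ : 2 * 2 - 2 = 2 :> R); last by ring.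
by rewrite -powRrM mulfV ?pnatr_eq0// powRr1// ltW.
Qed.

Lemma omegabar1 : omegabar a r 1 = r.
Proof.
apply/funext => j; rewrite /omegabar mulr1 subrr powRr0 mul1r invr1.
rewrite (_ : 2 - 1 = 1 :> R); last by ring.
by rewrite !powRr1// ?powR_ge0// ltW.
Qed.

Lemma wnorm_omegabar_leP (s B : R) x : 0 < s -> 0 <= B ->
  (wnorm (omegabar a r s) s x <= B%:E)%E <->
  (\esum_(j in [set: L]) (weight j * `|rescale x j| `^ s)%:E <= (B `^ s)%:E)%E.
Proof.
move=> s0 B0; rewrite wnorm_omegabar//; apply: poweR_inv_leP => //.
by apply: esum_ge0 => j _; rewrite lee_fin mulr_ge0 ?weight_ge0 ?powR_ge0.
Qed.

Lemma wnorm_ge0 (w : L -> R) (s : R) x : (0 <= wnorm w s x)%E.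
Proof. exact: poweR_ge0. Qed.

(** The term of a single [al] is at most the supremum; raised to the power [t], it bounds the
    measure of a superlevel set. *)
Lemma ktnorm_weak (t rho al : R) x : 0 < t -> 0 < rho -> 0 < al ->
  (ktnorm a r t x <= rho%:E)%E ->
  (\esum_(j in [set: L]) (if (al < `|rescale x j|)%R then weight j else 0)%:E
    <= (rho `^ t * al `^ (- t))%:E)%E.
Proof.
move=> t0 rho0 al0 kt.
set S := (X in (X <= _)%E).
have : (al%:E * poweR S t^-1 <= rho%:E)%E.
  apply: le_trans kt; apply: ereal_sup_ubound; exists al => //=.
  congr (_ * poweR _ _)%E; apply: eq_esum => j _.
  by rewrite threshold_rescale.
have q0 : 0 <= al^-1 * rho by rewrite mulr_ge0 ?invr_ge0 ?ltW.
have S0 : (0 <= S)%E.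
  by apply: esum_ge0 => j _; rewrite lee_fin; case: ifP => // _; rewrite weight_ge0.
rewrite -lee_pdivlMl// -EFinM => /(poweR_inv_leP t0 q0 S0).
rewrite powRM ?invr_ge0 ?(ltW al0) ?(ltW rho0)// -powR_inv1 ?(ltW al0)//.
by rewrite -powRrM mulN1r mulrC.
Qed.

End Rescale.

(** * Tikhonov minimizers compared with truncations of the true solution *)

Section Tikhonov.
Context {R : realType} {L : countType} {Y : completeNormedModType R}.
Variables (t Lc rho : R) (a r : L -> R) (D : set (L -> R)) (F : (L -> R) -> Y).
Variable xp : L -> R.
Hypotheses (t12 : 1 < t < 2) (HA1 : A1 a r D F Lc) (HA2 : A2 a D).
Hypotheses (rho0 : 0 < rho) (Dxp : D xp) (kt : (ktnorm a r t xp <= rho%:E)%E).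

Let N := rho `^ t.

Let N0 : 0 <= N. Proof. exact: powR_ge0. Qed.

Let t1 : 1 < t. Proof. by case/andP: t12. Qed.

Let t2 : t < 2. Proof. by case/andP: t12. Qed.

Let t0 : 0 < t. Proof. exact: lt_trans t1. Qed.

Let a0 : forall j, 0 < a j. Proof. by case: HA1 => -[]. Qed.

Let r0 : forall j, 0 < r j. Proof. by case: HA1 => -[]. Qed.

Let Lc0 : 0 < Lc. Proof. by case: HA1 => [_ [_ [_ [_ [_ []]]]]]. Qed.

Let weak (al : R) (al0 : 0 < al) := ktnorm_weak a0 r0 t0 rho0 al0 kt.

(** The upper Lipschitz inequality of (A1), squared: it carries truncation errors over to [Y]. *)
Lemma sqr_norm_image_le x y (B : R) : D x -> D y -> 0 <= B ->
  (\esum_(j in [set: L]) (weight a r j * `|rescale a r (vsub x y) j| `^ 2)%:E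
     <= B%:E)%E ->
  `|F x - F y| ^+ 2 <= Lc ^+ 2 * B.
Proof.
move=> Dx Dy B0 xyB; case: HA1 => [_ [_ [_ [_ [_ [_ lip]]]]]].
have [_ up] := lip _ _ Dx Dy.
have s0 : 0 <= B `^ 2^-1 := powR_ge0 _ _.
have sE : (B `^ 2^-1) `^ 2 = B by rewrite -powRrM mulVf ?pnatr_eq0// powRr1.
have two0 : 0 < 2 :> R by [].
have /(wnorm_omegabar_leP a0 r0 _ two0 s0) : (\esum_(j in [set: L])
    (weight a r j * `|rescale a r (vsub x y) j| `^ 2)%:E
     <= ((B `^ 2^-1) `^ 2)%:E)%E by rewrite sE.
rewrite omegabar2// => xys.
have : `|F x - F y| <= Lc * B `^ 2^-1.
  rewrite -lee_fin (le_trans up)// EFinM lee_wpmul2l// lee_fin; exact: ltW.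
rewrite -(@ler_pXn2r _ 2%N)// ?nnegrE// ?mulr_ge0 ?(ltW Lc0)//.
by rewrite exprMn -(powR_mulrn 2 s0) sE.
Qed.

(** The lower Lipschitz inequality of (A1), squared: it carries errors in [Y] back to L^2
    distances. *)
Lemma esum_sqr_sub_le x y : D x -> D y ->
  (\esum_(j in [set: L]) (weight a r j * `|rescale a r (vsub x y) j| `^ 2)%:E
     <= (Lc ^+ 2 * `|F x - F y| ^+ 2)%:E)%E.
Proof.
move=> Dx Dy; case: HA1 => [_ [_ [_ [_ [_ [_ lip]]]]]].
have [lw _] := lip _ _ Dx Dy.
have B0 : 0 <= Lc * `|F x - F y| by rewrite mulr_ge0 ?(ltW Lc0).
have two0 : 0 < 2 :> R by [].
rewrite -exprMn -(powR_mulrn 2 B0).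
apply/(wnorm_omegabar_leP a0 r0 _ two0 B0); rewrite omegabar2//.
by rewrite EFinM -lee_pdivrMl.
Qed.

(** The removed coordinates satisfy |y_j| <= b, and [esum_weak_below] with [q = 2 > t] sums their
    squares; the retained ones lie above [b], and [esum_weak_above] gives their l^1-norm because
    [1 < t]. *)
Lemma truncation (b : R) : 0 < b -> exists T, [/\ D T,
  `|F xp - F T| ^+ 2 <= Lc ^+ 2 * low_const t 2 * (N * b `^ (2 - t)) &
  (wnorm r 1 T <= (high_const t * (N * b `^ (1 - t)))%:E)%E].
Proof.
move=> b0; pose T j := if b < `|rescale a r xp j| then xp j else 0.
have Txp j : `|T j| <= `|xp j| by rewrite /T; case: ifP => _; rewrite ?normr0.
have DT : D T.
  (* (A2) asks for a finite l^2-norm of [T], which follows by comparison with x^+ term by term. *)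
  apply: (HA2 Dxp _ Txp); case: HA1 => [_ [_ [/(_ _ Dxp) xpoo _]]].
  apply: le_lt_trans xpoo; apply: gt0_ler_poweR.
  - by rewrite invr_ge0.
  - rewrite in_itv/= leey andbT; apply: esum_ge0 => j _.
    by rewrite lee_fin mulr_ge0 ?powR_ge0.
  - rewrite in_itv/= leey andbT; apply: esum_ge0 => j _.
    by rewrite lee_fin mulr_ge0 ?powR_ge0.
  - apply: le_esum => j _; rewrite lee_fin ler_wpM2l ?powR_ge0//.
    by apply: ge0_ler_powR; rewrite ?nnegrE.
have mu0 := weight_ge0 a0 r0.
have lo0 := low_const_ge0 t2; have hi0 := high_const_ge0 t1.
have y0 j : 0 <= `|rescale a r xp j| by [].
have TE j : rescale a r T j = if b < `|rescale a r xp j| then rescale a r xp j else 0.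
  by rewrite {1}/rescale /T; case: ifP => // _; rewrite mulr0 mul0r.
exists T; split=> //.
- rewrite -mulrA; apply: sqr_norm_image_le => //.
    exact: mulr_ge0 lo0 (mulr_ge0 N0 (powR_ge0 _ _)).
  apply: le_esum_EFin (esum_weak_below mu0 y0 t0 N0 weak t2 b0) => j.
  rewrite rescale_sub TE; case: ifP => _; last by rewrite subr0.
  by rewrite subrr normr0 powR0 ?mulr0 ?pnatr_eq0.
- rewrite -[X in wnorm X](omegabar1 a r0).
  apply/wnorm_omegabar_leP => //.
    exact: mulr_ge0 hi0 (mulr_ge0 N0 (powR_ge0 _ _)).
  rewrite [X in (_ <= X%:E)%E]powRr1; last first.
    exact: mulr_ge0 hi0 (mulr_ge0 N0 (powR_ge0 _ _)).
  apply: le_esum_EFin (esum_weak_above mu0 y0 N0 weak t1 b0) => j.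
  by rewrite powRr1// TE; case: ifP => // _; rewrite normr0 mulr0.
Qed.

(** A competitor of finite penalty makes the minimal value finite, so the penalty of the minimizer
    is a real number [w] and the comparison takes place in [R]. *)
Lemma minimizer_bound g (al S : R) x y : minimizer r D F g al x -> 0 < al ->
  D y -> (wnorm r 1 y <= S%:E)%E -> exists w : R, [/\ 0 <= w,
    wnorm r 1 x = w%:E &
    2^-1 * `|g - F x| ^+ 2 + al * w <= 2^-1 * `|g - F y| ^+ 2 + al * S].
Proof.
move=> [_ min] al0 Dy yS; have := min _ Dy.
have xw0 : (0 <= wnorm r 1 x)%E := wnorm_ge0 _ _ _.
have : ((2^-1 * `|g - F y| ^+ 2)%:E + al%:E * wnorm r 1 y <=
    (2^-1 * `|g - F y| ^+ 2 + al * S)%:E)%E.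
  by rewrite EFinD leeD2l// EFinM lee_wpmul2l// lee_fin ltW.
move=> yS' /le_trans/(_ yS'); case: (wnorm r 1 x) xw0 => [w| |]//.
  by rewrite !lee_fin => w0 h; exists w.
by rewrite gt0_muley ?lte_fin// addey// leye_eq.
Qed.

(** This reduces every rate to bounds on the penalty and on the image error at one threshold [b].
    The factor Lc^2 is the price of returning from [Y] to L^2; the powers of [rho] and [b] are the
    p-th root of N b^(p - t). *)
Lemma error_bound (p K1 K2 b : R) x : t < p <= 2 -> D x -> 0 < b ->
  0 <= K1 -> 0 <= K2 ->
  (wnorm r 1 x <= (K1 * (N * b `^ (1 - t)))%:E)%E ->
  `|F xp - F x| ^+ 2 <= K2 * (N * b `^ (2 - t)) ->
  (wnorm (omegabar a r p) p (vsub xp x) <=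
    ((Lc ^+ 2 * K2 + 1 + 4 * low_const t p + 8 * K1) `^ p^-1 *
       rho `^ (t / p) * b `^ ((p - t) / p))%:E)%E.
Proof.
move=> tp2 Dx b0 K10 K20; have /andP[tp p2] := tp2.
have p0 : 0 < p := lt_trans t0 tp.
rewrite -[X in wnorm X](omegabar1 a r0).
have K1N0 : 0 <= K1 * (N * b `^ (1 - t)) by rewrite !mulr_ge0 ?powR_ge0.
move=> /(wnorm_omegabar_leP a0 r0 _ ltr01 K1N0); rewrite [in X in X -> _]powRr1//.
move=> l1 l2.
have C0 : 0 <= Lc ^+ 2 * K2 + 1 + 4 * low_const t p + 8 * K1.
  have := low_const_ge0 tp; have := mulr_ge0 (exprn_ge0 2 (ltW Lc0)) K20; lra.
apply/wnorm_omegabar_leP => //; first by rewrite !mulr_ge0 ?powR_ge0.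
rewrite !powRM ?mulr_ge0 ?powR_ge0// -!powRrM !(mulrVK, mulVf) ?unitfE ?gt_eqF//.
rewrite powRr1// -mulrA.
under eq_esum do rewrite rescale_sub.
apply: esum_powR_sub_le => //.
- exact: weight_ge0.
- have Lc20 : 0 <= Lc ^+ 2 by rewrite exprn_ge0 ?(ltW Lc0).
  under eq_esum do rewrite -rescale_sub.
  rewrite (le_trans (esum_sqr_sub_le Dxp Dx))// lee_fin -mulrA.
  by rewrite ler_wpM2l.
- apply: le_esum_EFin l1 => j; by rewrite powRr1.
Qed.

(** [K] bounds the squared noise in units of N al^(2 - t), and [K1] the Tikhonov functional at the
    truncation. The squared residual of the minimizer is then at most 2 [K1] units, and its squared
    image error at most 2 [K] + 4 [K1]. *)
Definition apriori_const (p K : R) : R :=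
  let K1 := K + Lc ^+ 2 * low_const t 2 + high_const t in
  (Lc ^+ 2 * (2 * K + 4 * K1) + 1 + 4 * low_const t p + 8 * K1) `^ p^-1.

(** Truncating at [b = al] makes the squared approximation error and [al] times the l^1-norm both of
    order N al^(2 - t). Exact data and the a priori choice are both instances. *)
Lemma noisy_error_bound (p K delta al : R) g x : t < p <= 2 -> 0 <= K ->
  0 < al -> `|g - F xp| <= delta -> delta ^+ 2 <= K * (N * al `^ (2 - t)) ->
  minimizer r D F g al x ->
  (wnorm (omegabar a r p) p (vsub xp x) <=
    (apriori_const p K * rho `^ (t / p) * al `^ ((p - t) / p))%:E)%E.
Proof.
move=> tp2 K0 al0 gd dK xmin; have [Dx _] := xmin.
have [T [DT FT rT]] := truncation al0.
have [w [w0 wE wS]] := minimizer_bound xmin al0 DT rT.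
have ME : N * al `^ (2 - t) = al * (N * al `^ (1 - t)).
  rewrite mulrCA -{2}(powRr1 (ltW al0)) -powRD ?(gt_eqF al0) ?implybT//.
  by congr (_ * _ `^ _); ring.
have gT : `|g - F T| <= `|g - F xp| + `|F xp - F T|.
  by rewrite (le_trans _ (ler_normD _ _))// addrA subrK.
have xg : `|F xp - F x| <= `|g - F xp| + `|g - F x|.
  by rewrite -(distrC (F xp)) (le_trans _ (ler_normD _ _))// addrA subrK.
have gd2 : `|g - F xp| ^+ 2 <= delta ^+ 2 by rewrite ler_pXn2r ?nnegrE// (le_trans _ gd).
have lo0 := low_const_ge0 t2; have hi0 := high_const_ge0 t1.
have Lc20 : 0 <= Lc ^+ 2 by rewrite exprn_ge0 ?(ltW Lc0).
have Llo0 : 0 <= Lc ^+ 2 * low_const t 2 by rewrite mulr_ge0.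
have gT2 : `|g - F T| ^+ 2 <= 2 * `|g - F xp| ^+ 2 + 2 * `|F xp - F T| ^+ 2.
  have := normr_ge0 (g - F T); have := sqr_ge0 (`|g - F xp| - `|F xp - F T|).
  nra.
have xg2 : `|F xp - F x| ^+ 2 <= 2 * `|g - F xp| ^+ 2 + 2 * `|g - F x| ^+ 2.
  have := normr_ge0 (F xp - F x); have := sqr_ge0 (`|g - F xp| - `|g - F x|).
  nra.
have gx0 := sqr_ge0 `|g - F x|.
apply: error_bound => //.
- by rewrite !addr_ge0.
- by rewrite addr_ge0// mulr_ge0// !addr_ge0.
- rewrite wE lee_fin -(ler_pM2l al0).
  by rewrite ME in FT dK; move: (N * al `^ (1 - t)) wS FT dK => M' wS FT dK; lra.
- have : al * w >= 0 by rewrite mulr_ge0 ?(ltW al0).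
  by rewrite ME in FT dK *; move: (N * al `^ (1 - t)) wS FT dK => M' wS FT dK; lra.
Qed.

(** The threshold where truncation error and noise match: the positive solution b of N b^(2 - t) =
    delta^2. *)
Definition balance (delta : R) : R :=
  rho `^ (t / (t - 2)) * delta `^ (2 / (2 - t)).

Lemma balance_gt0 delta : 0 < delta -> 0 < balance delta.
Proof. by move=> d0; rewrite mulr_gt0 ?powR_gt0. Qed.

Lemma balanceE delta : 0 < delta -> N * balance delta `^ (2 - t) = delta ^+ 2.
Proof.
move=> d0; have t2n : 2 - t != 0 by rewrite subr_eq0 gt_eqF.
rewrite /balance powRM ?powR_ge0// -!powRrM divfK// powR_mulrn ?(ltW d0)//.
rewrite mulrA /N -powRD ?(gt_eqF rho0) ?implybT//.
rewrite (_ : t + _ = 0) ?powRr0 ?mul1r//.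
by field; rewrite subr_eq0 lt_eqF.
Qed.

Lemma balance_rate (p delta : R) : 0 < p -> 0 < delta ->
  rho `^ (t / p) * balance delta `^ ((p - t) / p) =
  rho `^ (t * (2 - p) / (p * (2 - t))) * delta `^ (2 * (p - t) / (p * (2 - t))).
Proof.
move=> p0 d0; have t2n : 2 - t != 0 by rewrite subr_eq0 gt_eqF.
have t2n' : t - 2 != 0 by rewrite subr_eq0 lt_eqF.
have pn : p != 0 by rewrite gt_eqF.
rewrite /balance powRM ?powR_ge0// -!powRrM mulrA.
rewrite -powRD ?(gt_eqF rho0) ?implybT//.
by congr (_ `^ _ * _ `^ _); field; rewrite ?t2n ?t2n' ?pn.
Qed.

(** The factor k for which truncation at the solution b of N b^(2 - t) = k delta^2 has image error
    at most (tau1 - 1) delta; the added 1 keeps the denominator positive. *)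
Definition discrepancy_scale (tau1 : R) : R :=
  (tau1 - 1) ^+ 2 / (Lc ^+ 2 * low_const t 2 + 1).

(** The constant of [error_bound] for an image error (1 + tau2) delta and the l^1 constant of the
    truncation; the last factor comes from the ratio of the threshold to [balance delta]. *)
Definition discrepancy_const (p tau1 tau2 : R) : R :=
  (Lc ^+ 2 * ((1 + tau2) ^+ 2 / discrepancy_scale tau1) + 1
    + 4 * low_const t p + 8 * high_const t) `^ p^-1
  * (discrepancy_scale tau1 `^ (2 - t)^-1) `^ ((p - t) / p).

(* At the threshold [b] chosen here the truncation has residual at most
   [tau1 * delta], hence no larger than that of the minimizer, so minimality
   compares the penalties whatever the regularization parameter is. *)
Lemma discrepancy_error_bound (p tau1 tau2 delta al : R) g x : t < p <= 2 ->
  1 < tau1 -> 0 < delta -> `|g - F xp| <= delta -> 0 < al ->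
  minimizer r D F g al x ->
  tau1 * delta <= `|F x - g| -> `|F x - g| <= tau2 * delta ->
  (wnorm (omegabar a r p) p (vsub xp x) <=
    (discrepancy_const p tau1 tau2 *
      (rho `^ (t / p) * balance delta `^ ((p - t) / p)))%:E)%E.
Proof.
move=> tp2 tau11 d0 gd al0 xmin lo up; have [Dx _] := xmin.
have lo0 := low_const_ge0 t2; have hi0 := high_const_ge0 t1.
have Llo0 : 0 <= Lc ^+ 2 * low_const t 2 by rewrite mulr_ge0 ?exprn_ge0 ?(ltW Lc0).
set k := discrepancy_scale tau1.
have k0 : 0 < k by rewrite divr_gt0 ?exprn_gt0 ?subr_gt0//; lra.
have t2n : 2 - t != 0 by rewrite subr_eq0 gt_eqF.
pose b := k `^ (2 - t)^-1 * balance delta.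
have b0 : 0 < b by rewrite mulr_gt0 ?powR_gt0 ?balance_gt0.
have bE : N * b `^ (2 - t) = k * delta ^+ 2.
  rewrite powRM ?powR_ge0 ?(ltW (balance_gt0 d0))// mulrCA balanceE//.
  by rewrite -powRrM mulVf// powRr1// ltW.
have [T [DT FT rT]] := truncation b0.
have [w [w0 wE wS]] := minimizer_bound xmin al0 DT rT.
have FTd : `|F xp - F T| <= (tau1 - 1) * delta.
  have tau0 : 0 <= (tau1 - 1) * delta by rewrite mulr_ge0 ?(ltW d0)//; lra.
  rewrite -(@ler_pXn2r _ 2%N)// ?nnegrE// (le_trans FT)// bE exprMn mulrA.
  rewrite ler_wpM2r ?sqr_ge0// /k /discrepancy_scale mulrCA.
  rewrite ler_piMr ?sqr_ge0// ler_pdivrMr; lra.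
have gT : `|g - F T| <= `|g - F x|.
  rewrite (distrC g (F x)) (le_trans _ lo)//.
  have : `|g - F T| <= `|g - F xp| + `|F xp - F T|.
    by rewrite (le_trans _ (ler_normD _ _))// addrA subrK.
  lra.
have gT2 : `|g - F T| ^+ 2 <= `|g - F x| ^+ 2 by rewrite ler_pXn2r ?nnegrE.
have xg : `|F xp - F x| <= (1 + tau2) * delta.
  have : `|F xp - F x| <= `|g - F xp| + `|F x - g|.
    by rewrite (distrC g) (distrC (F x)) (le_trans _ (ler_normD _ _))// addrA subrK.
  lra.
have K20 : 0 <= (1 + tau2) ^+ 2 / k by rewrite divr_ge0 ?sqr_ge0 ?ltW.
have := error_bound tp2 Dx b0 hi0 K20.
have K2E : (1 + tau2) ^+ 2 / k * (k * delta ^+ 2) = ((1 + tau2) * delta) ^+ 2.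
  by field; rewrite gt_eqF.
rewrite wE lee_fin bE K2E => H.
apply: le_trans (H _ _) _; first by rewrite -(ler_pM2l al0); lra.
  by rewrite ler_pXn2r ?nnegrE// (le_trans _ xg).
rewrite lee_fin /b powRM ?powR_ge0 ?(ltW (balance_gt0 d0))// /discrepancy_const -/k.
by rewrite le_eqVlt; apply/orP; left; apply/eqP; ring.
Qed.

End Tikhonov.

(** * Exact data, a priori parameter choice and discrepancy principle *)

Lemma wnorm_vsubC {R : realType} {L : countType} (w : L -> R) (p : R) x y :
  wnorm w p (vsub x y) = wnorm w p (vsub y x).
Proof. by congr poweR; apply: eq_esum => j _; rewrite /vsub distrC. Qed.

Theorem theorem5p4 (R : realType) (t p Lc : R) :
  1 < t < 2 -> t < p <= 2 -> 0 < Lc ->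
  (* (1) *)
  (exists Cb : R, forall (L : countType) (Y : completeNormedModType R)
     (a r : L -> R) (D : set (L -> R)) (F : (L -> R) -> Y)
     (xp : L -> R) (rho al : R) (xa : L -> R),
     A1 a r D F Lc -> A2 a D ->
     0 < rho -> D xp -> (ktnorm a r t xp <= rho%:E)%E ->
     0 < al -> minimizer r D F (F xp) al xa ->
     (wnorm (omegabar a r p) p (vsub xp xa)
        <= (Cb * rho `^ (t / p) * al `^ ((p - t) / p))%:E)%E) /\
  (* (2) *)
  (forall c1 c2 : R, 0 < c1 < c2 ->
   exists Cc : R, forall (L : countType) (Y : completeNormedModType R)
     (a r : L -> R) (D : set (L -> R)) (F : (L -> R) -> Y)
     (xp : L -> R) (rho delta al : R) (gobs : Y) (xh : L -> R),
     A1 a r D F Lc -> A2 a D ->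
     0 < rho -> D xp -> (ktnorm a r t xp <= rho%:E)%E ->
     0 < delta -> `|gobs - F xp| <= delta ->
     c1 * rho `^ (t / (t - 2)) * delta `^ (2 / (2 - t)) <= al ->
     al <= c2 * rho `^ (t / (t - 2)) * delta `^ (2 / (2 - t)) ->
     minimizer r D F gobs al xh ->
     (wnorm (omegabar a r p) p (vsub xh xp)
        <= (Cc * rho `^ (t * (2 - p) / (p * (2 - t)))
               * delta `^ (2 * (p - t) / (p * (2 - t))))%:E)%E) /\
  (* (3) *)
  (forall tau1 tau2 : R, 1 < tau1 <= tau2 ->
   exists Cd : R, forall (L : countType) (Y : completeNormedModType R)
     (a r : L -> R) (D : set (L -> R)) (F : (L -> R) -> Y)
     (xp : L -> R) (rho delta al : R) (gobs : Y) (xh : L -> R),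
     A1 a r D F Lc -> A2 a D ->
     0 < rho -> D xp -> (ktnorm a r t xp <= rho%:E)%E ->
     0 < delta -> `|gobs - F xp| <= delta ->
     0 < al -> minimizer r D F gobs al xh ->
     tau1 * delta <= `|F xh - gobs| -> `|F xh - gobs| <= tau2 * delta ->
     (wnorm (omegabar a r p) p (vsub xh xp)
        <= (Cd * rho `^ (t * (2 - p) / (p * (2 - t)))
               * delta `^ (2 * (p - t) / (p * (2 - t))))%:E)%E).
Proof.
move=> t12 tp2 Lc0; have /andP[t1 t2] := t12; have /andP[tp p2] := tp2.
have p0 : 0 < p by lra.
have s0 : 0 <= (p - t) / p by rewrite divr_ge0 ?subr_ge0 ?ltW.
split; last split.
- exists (apriori_const t Lc p 0) => L Y a r D F xp rho al xa HA1 HA2 rho0 Dxp kt.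
  (* For exact data the noise level and [K] are both 0. *)
  move=> al0 xmin; apply: (@noisy_error_bound _ _ _ t Lc rho a r D F xp t12 HA1
    HA2 rho0 Dxp kt p 0 0 al (F xp)) => //; first by rewrite subrr normr0.
  by rewrite expr0n mul0r.
- move=> c1 c2 /andP[c10 c12]; have c20 := lt_trans c10 c12.
  (* The lower bound on [al] gives balance <= al / c1, hence delta^2 = N balance^(2 - t) <= K N
     al^(2 - t). *)
  pose K := (c1^-1) `^ (2 - t).
  (* The factor in [c2] absorbs the upper bound al <= c2 balance in the rate. *)
  exists (apriori_const t Lc p K * c2 `^ ((p - t) / p)).
  move=> L Y a r D F xp rho delta al g xh HA1 HA2 rho0 Dxp kt d0 gd lo up xmin.
  have b0 := balance_gt0 t rho0 d0.
  rewrite -mulrA in lo; rewrite -mulrA in up.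
  have al0 : 0 < al by rewrite (lt_le_trans _ lo)// mulr_gt0.
  have dK : delta ^+ 2 <= K * (rho `^ t * al `^ (2 - t)).
    rewrite -(balanceE t12 rho0 d0) mulrCA ler_wpM2l ?powR_ge0//.
    rewrite -powRM ?invr_ge0 ?(ltW c10) ?(ltW al0)//.
    have bal : balance t rho delta <= c1^-1 * al by rewrite ler_pdivlMl.
    have cal0 := le_trans (ltW b0) bal.
    by apply: ge0_ler_powR bal; rewrite ?nnegrE ?subr_ge0//; exact: ltW.
  rewrite wnorm_vsubC.
  apply: le_trans (noisy_error_bound t12 HA1 HA2 rho0 Dxp kt tp2 (powR_ge0 _ _)
    al0 gd dK xmin) _.
  rewrite lee_fin -[leRHS]mulrA -(balance_rate t12 rho0 p0 d0) -!mulrA.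
  rewrite ler_wpM2l ?powR_ge0// mulrCA ler_wpM2l ?powR_ge0//.
  rewrite -powRM ?(ltW c20) ?(ltW b0)//.
  have cb0 := le_trans (ltW al0) up.
  by apply: ge0_ler_powR up; rewrite ?nnegrE ?(ltW al0).
- move=> tau1 tau2 /andP[tau11 _]; exists (discrepancy_const t Lc p tau1 tau2).
  move=> L Y a r D F xp rho delta al g xh HA1 HA2 rho0 Dxp kt d0 gd al0 xmin lo up.
  rewrite wnorm_vsubC -mulrA -(balance_rate t12 rho0 p0 d0).
  exact: (discrepancy_error_bound t12 HA1 HA2 rho0 Dxp kt tp2 tau11 d0 gd al0 xmin).
Qed.
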